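(* Let $G$ be a group, $N$ a normal subgroup of $G$, and $q\colon G\to G/N$ the projection. Assume that there exist a subgroup $\Lambda$ of finite index of $G/N$ and a group homomorphism $s\colon\Lambda\to G$ such that $q\circ s(\lambda)=\lambda$ for every $\lambda\in\Lambda$. Then for every $x\in[G,N]$, $$\mathrm{scl}_G(x)\le\mathrm{scl}_{G,N}(x)\le 2\cdot\mathrm{scl}_G(x).$$
   Context: Commutators are $[g,h]=ghg^{-1}h^{-1}$. A $(G,N)$-commutator is an element $[g,h]$ with $g\in G$, $h\in N$; $[G,N]$ is the subgroup they generate. For $x\in[G,N]$, $\mathrm{cl}_{G,N}(x)$ is the minimal $n\ge0$ such that $x$ is a product of $n$ $(G,N)$-commutators, and $\mathrm{scl}_{G,N}(x)=\lim_{n\to\infty}\mathrm{cl}_{G,N}(x^n)/n$. For $x\in[G,G]$, $\mathrm{cl}_G(x)$ is the minimal number of commutators of elements of $G$ whose product is $x$, and $\mathrm{scl}_G(x)=\lim_{n\to\infty}\mathrm{cl}_G(x^n)/n$. *)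

(* Defs.v *)
From HB Require Import structures.
From mathcomp Require Import all_boot all_order all_algebra.
From mathcomp Require Import boolp classical_sets functions cardinality.
From mathcomp Require Import reals topology normedtype sequences.

Set Implicit Arguments.
Unset Strict Implicit.
Unset Printing Implicit Defensive.

Import GRing.Theory Num.Theory numFieldNormedType.Exports.
Local Open Scope classical_set_scope.
Local Open Scope quotient_scope.
Local Open Scope group_scope.

(* Groups are MathComp's [groupType]s (possibly infinite). Subgroups are
   [groupClosed] boolean predicates; under the classical axioms of boolp every
   subset is of this form. *)

HB.mixin Record isConjClosed (G : groupType) (N : {pred G}) := {
  gpred_conjl : forall g : G, {in N, forall h, g * h * g^-1 \in N}
}.

#[short(type="normalClosed")]
HB.structure Definition NormalClosed (G : groupType) :=
  {N of GroupClosed G N & isConjClosed G N}.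

Section Quotient.
Variables (G : groupType) (N : normalClosed G).

Definition quot_equiv (x y : G) := x^-1 * y \in N.

Lemma quot_equiv_is_equiv : equiv_class_of quot_equiv.
Proof.
split=> [x|x y|y x z]; rewrite /quot_equiv.
- by rewrite mulVg gpred1.
- by rewrite -[in RHS]gpredV invgM invgK.
- by move=> xy yz; rewrite -[x^-1](mulgK y) -mulgA gpredM.
Qed.

Canonical quot_equiv_equiv := EquivRelPack quot_equiv_is_equiv.
Canonical quot_equiv_enc := defaultEncModRel quot_equiv.

Definition quotg := {eq_quot quot_equiv}.

HB.instance Definition _ : EqQuotient G quot_equiv quotg :=
  EqQuotient.on quotg.
HB.instance Definition _ := Choice.on quotg.

Definition quotg_one : quotg := lift_cst quotg (1 : G).
Definition quotg_mul := lift_op2 quotg (fun x y : G => x * y).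
Definition quotg_inv := lift_op1 quotg (fun x : G => x^-1).

Canonical pi_quotg_one_morph := PiConst quotg_one.

Lemma pi_quotg_inv : {morph \pi : x / x^-1 >-> quotg_inv x}.
Proof.
move=> x; unlock quotg_inv; apply/eqP; rewrite piE /= /quot_equiv invgK.
have /eqP : x = repr (\pi_quotg x) %[mod quotg] by rewrite reprK.
rewrite piE /= /quot_equiv => xr.
set r := repr _ in xr *.
rewrite -gpredV in xr.
have := gpred_conjl x _ xr.
by rewrite invgM invgK !mulgA mulgK.
Qed.
Canonical pi_quotg_inv_morph := PiMorph1 pi_quotg_inv.

Lemma pi_quotg_mul : {morph \pi : x y / x * y >-> quotg_mul x y}.
Proof.
move=> x y; unlock quotg_mul; apply/eqP; rewrite piE /= /quot_equiv.
have /eqP : x = repr (\pi_quotg x) %[mod quotg] by rewrite reprK.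
have /eqP : y = repr (\pi_quotg y) %[mod quotg] by rewrite reprK.
rewrite !piE /= /quot_equiv; set r := repr _; set s := repr _ => ys xr.
have := gpredM _ _ (gpred_conjl y^-1 _ xr) ys.
by rewrite invgK invgM !mulgA mulgK.
Qed.
Canonical pi_quotg_mul_morph := PiMorph2 pi_quotg_mul.

Lemma quotg_mulA : associative quotg_mul.
Proof. by move=> x y z; rewrite -[x]reprK -[y]reprK -[z]reprK !piE mulgA. Qed.
Lemma quotg_mul1 : left_id quotg_one quotg_mul.
Proof. by move=> x; rewrite -[x]reprK !piE mul1g. Qed.
Lemma quotg_mulr1 : right_id quotg_one quotg_mul.
Proof. by move=> x; rewrite -[x]reprK !piE mulg1. Qed.
Lemma quotg_mulV : left_inverse quotg_one quotg_inv quotg_mul.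
Proof. by move=> x; rewrite -[x]reprK !piE mulVg. Qed.
Lemma quotg_mulVr : right_inverse quotg_one quotg_inv quotg_mul.
Proof. by move=> x; rewrite -[x]reprK !piE mulgV. Qed.

HB.instance Definition _ := isGroup.Build quotg
  quotg_mulA quotg_mul1 quotg_mulr1 quotg_mulV quotg_mulVr.

Definition quot_proj : G -> quotg := \pi_quotg.

Lemma quot_projM : {morph quot_proj : x y / x * y}.
Proof. by move=> x y; rewrite /quot_proj [LHS]pi_quotg_mul. Qed.

HB.instance Definition _ := isMultiplicative.Build G quotg quot_proj quot_projM.

End Quotient.

Section Subgroup.
Variables (G : groupType) (H : groupClosed G).

Record subgroup := Subgroup { subgroup_val : G; _ : subgroup_val \in H }.

HB.instance Definition _ := [isSub for subgroup_val].
HB.instance Definition _ := [Choice of subgroup by <:].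

Lemma subgroup_closed : group_closed H.
Proof. by split; [exact: gpred1|move=> x y; exact: gpredF]. Qed.

HB.instance Definition _ :=
  SubChoice_isSubGroup.Build G _ subgroup subgroup_closed.

Definition left_coset (g : G) : set G := [set g * h | h in [set` H]].

Definition finite_index : Prop := finite_set (range left_coset).

End Subgroup.

Section CommutatorLength.
Variable G : groupType.
Implicit Types (S N : set G) (x : G).

(* Not MathComp's [~ g, h], which is g^-1 * h^-1 * g * h. *)
Definition comm (g h : G) : G := g * h * g^-1 * h^-1.

Definition mixed_comms N : set G := [set comm g h | g in setT & h in N].

Definition generated S : set G :=
  smallest [set H : set G | group_closed [in H]] S.

Definition mixed_comm_subgroup N : set G := generated (mixed_comms N).

Definition is_product S (n : nat) x : Prop :=
  exists2 t : n.-tuple G, {in t, forall c, S c} & x = \prod_(c <- t) c.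

(* The junk value 0 is taken when x is not a product of elements of S. *)
Definition word_length S x : nat :=
  xget 0%N [set n | is_product S n x
                    /\ forall m, is_product S m x -> (n <= m)%N].

Definition mixed_cl N x : nat := word_length (mixed_comms N) x.

Definition cl x : nat := word_length [set comm g h | g in setT & h in setT] x.

(* By Fekete's lemma the limits below exist for x in the relevant commutator
   subgroup. *)
Definition mixed_scl (R : realType) N x : R :=
  limn (fun n => (mixed_cl N (x ^+ n))%:R / n%:R : R)%R.

Definition scl (R : realType) x : R :=
  limn (fun n => (cl (x ^+ n))%:R / n%:R : R)%R.

End CommutatorLength.

(* Main.v *)
(* Let H be the preimage of Lambda, so that H is the semidirect product of N and
   s(Lambda). Write x^m as a product of n commutators, i.e. as a word of 4n
   letters made of 2n pairs y, y^-1. Conjugating by representatives t_i of the r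
   cosets of H and inserting them between the letters writes each t_i x^m t_i^-1
   as a word in H; over all i together these letters form 2nr inverse pairs.
   Splitting each letter of H as a * sigma with a in N and moving the sigma's to
   the right, where they cancel because x is in N, leaves conjugates of the a's,
   which are pairwise inverse up to conjugation in G. Each such pair can be
   removed at the cost of one (G,N)-commutator, since c v (p c^-1 p^-1) v^-1 is
   one. As t_i x^m t_i^-1 and x^m differ by one more (G,N)-commutator,
   cl_{G,N}(x^(m r)) <= r + 2 r cl_G(x^m); divide by m r and let m grow. *)
Require Import Defs.
From mathcomp Require Import all_boot all_order all_algebra.
From mathcomp Require Import boolp classical_sets cardinality.
From mathcomp Require Import reals topology normedtype sequences.
From mathcomp Require Import ring lra.

Set Implicit Arguments.
Unset Strict Implicit.
Unset Printing Implicit Defensive.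

Import Order.TTheory GRing.Theory Num.Theory numFieldNormedType.Exports.
Local Open Scope classical_set_scope.

(** * Subadditive sequences and limits of averages *)

Section Subadditive.
Local Open Scope ring_scope.

(** Fekete's lemma: the limit is the infimum of [u n / n] over positive [n]. Dividing [n] by an [m]
    with [u m / m] close to the infimum leaves an error bounded independently of [n]. *)
Lemma fekete_cvg (R : realType) (u : nat -> nat) :
  (forall m n, (u (m + n) <= u m + u n)%N) ->
  cvgn (fun n => (u n)%:R / n%:R : R).
Proof.
move=> usub.
pose E := [set ((u n.+1)%:R / n.+1%:R : R) | n in setT].
have E0 : E !=set0 by exists ((u 1%N)%:R / 1%:R); exists 0%N.
have Elb : has_lbound E by exists 0 => _ [n _ <-]; exact: divr_ge0.
apply/cvg_ex; exists (inf E); apply/cvgrPdist_lep.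
near=> e; have e0 : 0 < e by near: e; exact: nbhs_right_gt.
have e20 : 0 < e / 2 by rewrite divr_gt0.
have [_ [m' _ <-] lte] := inf_adherent e20 (conj E0 Elb).
set m := m'.+1 in lte.
(* [C] bounds [u] on every remainder modulo [m]. *)
pose C := (u 0%N + m * u 1%N)%N.
have u_lin (r : nat) : (u r <= u 0%N + r * u 1%N)%N.
  elim: r => [|r IH]; first by rewrite mul0n addn0.
  by rewrite mulSn addnCA -add1n (leq_trans (usub _ _))// leq_add2l.
have u_mod (q r : nat) : (u (q * m + r) <= q * u m + u r)%N.
  elim: q => [|q IH]; first by [].
  by rewrite !mulSn -!addnA (leq_trans (usub _ _))// leq_add2l.
have uC (n : nat) : (u n)%:R <= n%:R * ((u m)%:R / m%:R) + C%:R :> R.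
  rewrite {1}(divn_eq n m).
  apply: (@le_trans _ _ ((n %/ m * u m + u (n %% m))%N%:R)).
    by rewrite ler_nat.
  rewrite natrD lerD//; last first.
    rewrite ler_nat (leq_trans (u_lin _))// leq_add2l leq_mul2r.
    by rewrite ltnW ?orbT// ltn_mod.
  rewrite natrM mulrA mulrAC ler_wpM2r// ler_pdivlMr ?ltr0n//.
  by rewrite -natrM ler_nat leq_divM.
near=> n; have n0 : (0 < n)%N by near: n; exact: nbhs_infty_gt.
have n0R : 0 < n%:R :> R by rewrite ltr0n.
have lbn : inf E <= (u n)%:R / n%:R.
  by apply: ge_inf => //; exists n.-1; rewrite ?prednK.
rewrite distrC ger0_norm ?subr_ge0// lerBlDl.
have Cn : C%:R / n%:R <= e / 2.
  rewrite ler_pdivrMr// -ler_pdivrMl//.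
  by near: n; exact: nbhs_infty_ger.
have : (u n)%:R / n%:R <= (u m)%:R / m%:R + C%:R / n%:R :> R.
  by rewrite ler_pdivrMr// mulrDl divfK ?gt_eqF// mulrC uC.
move: lte Cn; lra.
Unshelve. all: by end_near. Qed.

(** Comparison along the multiples of [r]: after division by [m * r] the summand [r] becomes [1 / m]
    and vanishes in the limit. *)
Lemma limn_div_le_double (R : realType) (u v : nat -> nat) (r : nat) :
  (0 < r)%N ->
  (forall m, (u (m * r) <= r + r * 2 * v m)%N) ->
  cvgn (fun n => (u n)%:R / n%:R : R) -> cvgn (fun n => (v n)%:R / n%:R : R) ->
  limn (fun n => (u n)%:R / n%:R : R) <= 2 * limn (fun n => (v n)%:R / n%:R : R).
Proof.
move=> r0 uv cu cv.
have cur : (u (m * r)%N)%:R / (m * r)%N%:R @[m --> \oo] -->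
    limn (fun n => (u n)%:R / n%:R : R).
  apply: (@cvg_comp _ _ _ (fun m => (m * r)%N) 
    (fun n => (u n)%:R / n%:R : R) _ \oo) => //.
  move=> P [K _ KP]; exists K => // n /= Kn; apply: KP => /=.
  by rewrite (leq_trans Kn)// leq_pmulr.
(* The shift to [m.+1] keeps the denominators nonzero. *)
have cb : m.+1%:R^-1 + 2 * ((v m.+1)%:R / m.+1%:R) @[m --> \oo] -->
    0 + 2 * limn (fun n => (v n)%:R / n%:R : R).
  apply: cvgD; first exact: cvg_harmonic.
  apply: cvgMl_tmp.
  by move: cv; rewrite -(cvg_shiftS (fun n => (v n)%:R / n%:R : R)).
rewrite -[leRHS]add0r; move: cur.
rewrite -(cvg_shiftS (fun m => (u (m * r)%N)%:R / (m * r)%N%:R : R)) => cur.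
apply: (ler_cvg_to cur cb); near=> m => /=.
have m0 : 0 < m.+1%:R :> R by rewrite ltr0n.
have r0R : 0 < r%:R :> R by rewrite ltr0n.
rewrite ler_pdivrMr ?ltr0n ?muln_gt0//.
apply: (@le_trans _ _ ((r + r * 2 * v m.+1)%N%:R)); first by rewrite ler_nat.
rewrite natrD !natrM le_eqVlt; apply/orP; left; apply/eqP; field.
by rewrite addrC natr1 pnatr_eq0.
Unshelve. all: by end_near. Qed.

End Subadditive.

Local Open Scope group_scope.

(** * Products of elements of a set and word length *)

Lemma is_productP (G : groupType) (S : set G) (n : nat) (x : G) :
  is_product S n x <->
  exists t : seq G, [/\ size t = n, {in t, forall c, S c} & x = \prod_(c <- t) c].
Proof.
split=> [[t tS ->]|[t [tn tS ->]]]; first by exists t; rewrite size_tuple.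
by have /eqP tn' := tn; exists (Tuple tn').
Qed.

Lemma is_product1 (G : groupType) (S : set G) : is_product S 0 1.
Proof. by apply/is_productP; exists [::]; rewrite big_nil. Qed.

Lemma is_product_gen (G : groupType) (S : set G) (c : G) :
  S c -> is_product S 1 c.
Proof.
move=> Sc; apply/is_productP; exists [:: c]; split=> //; last by rewrite big_seq1.
by move=> d; rewrite inE => /eqP ->.
Qed.

Lemma is_productM (G : groupType) (S : set G) (m n : nat) (x y : G) :
  is_product S m x -> is_product S n y -> is_product S (m + n) (x * y).
Proof.
move=> /is_productP[s [<- sS ->]] /is_productP[t [<- tS ->]].
apply/is_productP; exists (s ++ t); rewrite size_cat big_cat; split=> // c.
by rewrite mem_cat => /orP[/sS|/tS].
Qed.

Lemma is_productX (G : groupType) (S : set G) (n k : nat) (x : G) :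
  is_product S n x -> is_product S (k * n) (x ^+ k).
Proof.
move=> xn; elim: k => [|k IH]; first exact: is_product1.
by rewrite expgS mulSn; exact: is_productM.
Qed.

Lemma is_productV (G : groupType) (S : set G) (n : nat) (x : G) :
  (forall c, S c -> S c^-1) -> is_product S n x -> is_product S n x^-1.
Proof.
move=> SV /is_productP[s [<- {n} + ->]]; elim: s => [|c s IH] sS.
  by rewrite big_nil invg1; exact: is_product1.
rewrite big_cons invgM /= -addn1; apply: is_productM; last first.
  by apply/is_product_gen/SV/sS; rewrite mem_head.
by apply: IH => d ds; apply: sS; rewrite inE ds orbT.
Qed.

Lemma is_productJ (G : groupType) (S : set G) (n : nat) (g x : G) :
  (forall c, S c -> S (g * c * g^-1)) ->
  is_product S n x -> is_product S n (g * x * g^-1).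
Proof.
move=> SJ /is_productP[s [<- {n} + ->]]; elim: s => [|c s IH] sS.
  by rewrite big_nil mulg1 mulgV; exact: is_product1.
rewrite big_cons /= -add1n.
rewrite (_ : g * _ * _ = (g * c * g^-1) * (g * \prod_(c <- s) c * g^-1));
  last by rewrite !mulgA mulgVK.
apply: is_productM; first by apply/is_product_gen/SJ/sS; rewrite mem_head.
by apply: IH => d ds; apply: sS; rewrite inE ds orbT.
Qed.

(** One expression of [x] as a product yields a shortest one, which excludes the default case of
    [xget]. *)
Lemma word_lengthP (G : groupType) (S : set G) (n : nat) (x : G) :
  is_product S n x ->
  is_product S (word_length S x) x /\ (word_length S x <= n)%N.
Proof.
move=> xn; rewrite /word_length; case: xgetP => [m _ [xm mmin]|none].
  by split=> //; exact: mmin.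
have ex : exists k, `[< is_product S k x >] by exists n; apply/asboolP.
case: (ex_minnP ex) => m /asboolP xm mmin; case: (none m); split=> // k xk.
by apply: mmin; apply/asboolP.
Qed.

Lemma word_lengthX_subadditive (G : groupType) (S : set G) (n : nat) (x : G) :
  is_product S n x -> forall k l,
  (word_length S (x ^+ (k + l)) <= word_length S (x ^+ k) + word_length S (x ^+ l))%N.
Proof.
move=> xn k l; rewrite expgnDr.
have [xk _] := word_lengthP (is_productX k xn).
have [xl _] := word_lengthP (is_productX l xn).
by have [] := word_lengthP (is_productM xk xl).
Qed.

(** For [S] closed under inversion the finite products form a subgroup containing [S], hence
    containing the smallest such. *)
Lemma generated_is_product (G : groupType) (S : set G) (x : G) :
  (forall c, S c -> S c^-1) -> generated S x -> exists n, is_product S n x.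
Proof.
move=> SV xS; apply: (xS [set y | exists n, is_product S n y]).
split=> /=; last by move=> c Sc; exists 1%N; exact: is_product_gen.
split=> [|y z]; first by rewrite !inE; exists 0%N; exact: is_product1.
rewrite !inE => -[m ym] [n zn]; exists (m + n)%N.
by apply: is_productM => //; exact: is_productV.
Qed.

(** * Mixed commutators *)

Section MixedCommutators.
Variables (G : groupType) (N : normalClosed G).

Lemma mixed_commsV (c : G) : mixed_comms [set` N] c -> mixed_comms [set` N] c^-1.
Proof.
move=> [g _ [h Nh <-]]; exists g^-1 => //; exists (g * h * g^-1).
  exact: gpred_conjl.
by rewrite /comm !gnorm.
Qed.

Lemma mixed_commsJ (g c : G) :
  mixed_comms [set` N] c -> mixed_comms [set` N] (g * c * g^-1).
Proof.
move=> [k _ [h Nh <-]]; exists (g * k * g^-1) => //; exists (g * h * g^-1).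
  exact: gpred_conjl.
by rewrite /comm !gnorm.
Qed.

Lemma mixed_comm_subgroup_sub (x : G) :
  mixed_comm_subgroup [set` N] x -> x \in N.
Proof.
move=> xS; apply: (xS [set y | y \in N]); split=> [|c [g _ [h Nh <-]]] /=.
  by split=> [|y z]; rewrite !inE; [exact: gpred1|exact: gpredF].
by rewrite /comm -[g * h * g^-1 * h^-1]/(_ / h) gpredF // gpred_conjl.
Qed.

Lemma mixed_comm_mem (g h : G) : h \in N -> mixed_comms [set` N] (comm h g).
Proof.
move=> Nh; rewrite (_ : comm h g = (comm g h)^-1); last by rewrite /comm !gnorm.
by apply: mixed_commsV; exists g => //; exists h.
Qed.

(** The longer word is the conjugate [u * comm c (v * p) * u^-1] times [u * v * w]. *)
Lemma is_product_insert_pair (n : nat) (u v w c p : G) : c \in N ->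
  is_product (mixed_comms [set` N]) n (u * v * w) ->
  is_product (mixed_comms [set` N]) n.+1
    (u * c * v * (p * c^-1 * p^-1) * w).
Proof.
move=> Nc uvw.
rewrite (_ : _ * w = (u * comm c (v * p) * u^-1) * (u * v * w));
  last by rewrite /comm !gnorm.
rewrite -add1n; apply: is_productM => //.
by apply/is_product_gen/mixed_commsJ/mixed_comm_mem.
Qed.

End MixedCommutators.

(** * Words balanced up to conjugation *)

Lemma prod_conj (G : groupType) (g : G) (w : seq G) :
  \prod_(c <- [seq g * c * g^-1 | c <- w]) c = g * (\prod_(c <- w) c) * g^-1.
Proof.
elim: w => [|c w IH] /=; first by rewrite !big_nil !gnorm.
by rewrite !big_cons IH !gnorm.
Qed.

(* A chosen representative of the conjugacy class of [x], so that being equal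
   up to conjugation termwise and reordering becomes [perm_eq] of images. *)
Definition conj_repr (G : groupType) (x : G) : G :=
  xget 1 [set y | exists p, y = p * x * p^-1].

Lemma conj_repr_conj (G : groupType) (p x : G) :
  conj_repr (p * x * p^-1) = conj_repr x.
Proof.
rewrite /conj_repr; congr xget; apply/seteqP; split=> y [q ->].
  by exists (q * p); rewrite !gnorm.
by exists (q * p^-1); rewrite !gnorm.
Qed.

Lemma conj_repr_eq (G : groupType) (x y : G) :
  conj_repr x = conj_repr y -> exists p, y = p * x * p^-1.
Proof.
have mem (z : G) : exists p, conj_repr z = p * z * p^-1.
  apply: (@xgetPex _ 1 [set y | exists p, y = p * z * p^-1]).
  by exists z, 1; rewrite !gnorm.
have [p ->] := mem x; have [q ->] := mem y => pq.
exists (q^-1 * p); apply: (mulgI q); apply: (mulIg q^-1).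
by rewrite -pq !gnorm.
Qed.

(** Induction on [cs]: one letter of [w] is conjugate to [c], another to [c^-1], and deleting both
    costs one mixed commutator. *)
Lemma balanced_is_product (G : groupType) (N : normalClosed G) (w cs : seq G) :
  {in cs, forall c, c \in N} ->
  perm_eq (map (@conj_repr G) w)
    (map (@conj_repr G) (cs ++ map (fun c => c^-1) cs)) ->
  is_product (mixed_comms [set` N]) (size cs) (\prod_(c <- w) c).
Proof.
elim: cs w => [|c cs IH] w csN /=.
  by move=> /perm_nilP/eqP; case: w => // _; rewrite big_nil; exact: is_product1.
have Nc : c \in N by apply: csN; rewrite mem_head.
have csN' : {in cs, forall c, c \in N}.
  by move=> d ds; apply: csN; rewrite inE ds orbT.
move=> weq; have : conj_repr c \in map (@conj_repr G) w.
  by rewrite (perm_mem weq) mem_head.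
case/mapP=> x xw cx; case/splitPr: xw weq => u v weq.
have {}weq : perm_eq (map (@conj_repr G) (u ++ v))
    (conj_repr c^-1 :: map (@conj_repr G) (cs ++ map (fun c => c^-1) cs)).
  rewrite -(perm_cons (conj_repr c)).
  apply: perm_trans (perm_trans weq _).
    by rewrite !map_cat /= cx perm_sym (perm_catCA _ [:: _]).
  by rewrite perm_cons !map_cat /= (perm_catCA _ [:: _]).
have [p px] := conj_repr_eq cx.
have Nx : x \in N by rewrite px; exact: gpred_conjl.
have : conj_repr c^-1 \in map (@conj_repr G) (u ++ v).
  by rewrite (perm_mem weq) mem_head.
case/mapP=> y yuv cy; have [q qy] := conj_repr_eq cy.
have Ny : y \in N by rewrite qy; apply: gpred_conjl; rewrite gpredV.
have drop (a b : seq G) :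
    perm_eq (map (@conj_repr G) (a ++ y :: b))
      (conj_repr c^-1 :: map (@conj_repr G) (cs ++ map (fun c => c^-1) cs)) ->
    is_product (mixed_comms [set` N]) (size cs) (\prod_(c <- a ++ b) c).
  move=> abeq; apply: IH => //; rewrite -(perm_cons (conj_repr c^-1)).
  apply: perm_trans abeq.
  by rewrite !map_cat /= cy perm_sym (perm_catCA _ [:: _]).
(* Whichever of [x] and [y] comes first serves as the inserted letter; the other is a conjugate of
   its inverse. *)
move: yuv; rewrite mem_cat => /orP[] ys.
  case/splitPr: ys weq => u1 u2; rewrite -catA => /drop.
  rewrite catA !big_cat /= !big_cons => uvw.
  have xy : x = (p * q^-1) * y^-1 * (p * q^-1)^-1 by rewrite qy px !gnorm.
  rewrite ?mulgA in uvw; have := is_product_insert_pair (p * q^-1) Ny uvw.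
  by rewrite -xy !mulgA.
case/splitPr: ys weq => v1 v2; rewrite catA => /drop.
rewrite -catA !big_cat /= big_cons big_cat /= big_cons => uvw.
have yx : y = (q * p^-1) * x^-1 * (q * p^-1)^-1 by rewrite qy px !gnorm.
rewrite ?mulgA in uvw; have := is_product_insert_pair (q * p^-1) Nx uvw.
by rewrite -yx !mulgA.
Qed.

(* [act] is a right action on the finite set [idx] of cosets, and the twisted
   cocycle [a i] splits each factor of a product over the orbit of [i]. As [g]
   runs over a word, every letter is seen exactly once from each index. *)
Section Cocycle.
Variables (G : groupType) (I : eqType).
Variables (act : I -> G -> I) (a s : I -> G -> G) (idx : seq I).
Hypothesis act_perm : forall g, perm_eq (map (act^~ g) idx) idx.
Hypothesis a1 : {in idx, forall i, a i 1 = 1}.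
Hypothesis aM : forall i g h,
  a i (g * h) = a i g * (s i g * a (act i g) h * (s i g)^-1).

Fixpoint cocycle_word (i : I) (ys : seq G) : seq G :=
  if ys is y :: ys' then
    a i y :: [seq s i y * c * (s i y)^-1 | c <- cocycle_word (act i y) ys']
  else [::].

Lemma act_mem (i : I) (g : G) : i \in idx -> act i g \in idx.
Proof. by move=> iin; rewrite -(perm_mem (act_perm g)); exact: map_f. Qed.

Lemma prod_cocycle_word (ys : seq G) (i : I) : i \in idx ->
  \prod_(c <- cocycle_word i ys) c = a i (\prod_(y <- ys) y).
Proof.
elim: ys i => [|y ys IH] i iin /=; first by rewrite !big_nil a1.
by rewrite !big_cons prod_conj IH ?act_mem// aM.
Qed.

(** As [i] runs over [idx], so does [act i y]; the tails after the first letter are thus again those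
    of all indices, up to conjugations that [conj_repr] ignores. *)
Lemma perm_cocycle_words (ys : seq G) :
  perm_eq (map (@conj_repr G) (flatten [seq cocycle_word i ys | i <- idx]))
    [seq conj_repr (a i y) | y <- ys, i <- idx].
Proof.
rewrite map_flatten -map_comp.
elim: ys => [|y ys IH] /=; first by elim: idx.
pose W i := map (@conj_repr G) (cocycle_word i ys).
have -> : [seq (map (@conj_repr G) \o cocycle_word^~ (y :: ys)) i | i <- idx] =
    [seq [seq f | f <- conj_repr (a i y) :: W (act i y)] | i <- idx].
  apply: eq_map => i /=; rewrite map_id; congr cons; rewrite -map_comp.
  by apply: eq_map => c /=; exact: conj_repr_conj.
apply: perm_trans (_ : perm_eq _ ([seq conj_repr (a i y) | i <- idx] ++
    [seq f | i <- idx, f <- W (act i y)])) _.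
  by rewrite (perm_allpairs_consr (fun _ f => f)).
rewrite perm_cat2l; apply: perm_trans IH.
rewrite (eq_map (fun i => map_id (W (act i y)))) (map_comp W (act^~ y)).
exact/perm_flatten/perm_map.
Qed.

(** By [aM] for [g] and [g^-1], [a (act i g) g^-1] is conjugate to [(a i g)^-1]; it remains to
    reindex by the permutation [act^~ g]. *)
Lemma perm_cocycleV (g : G) : perm_eq [seq conj_repr (a i g^-1) | i <- idx]
  [seq conj_repr (a i g)^-1 | i <- idx].
Proof.
apply: (@perm_trans _ [seq conj_repr (a i g^-1) | i <- map (act^~ g) idx]).
  by apply: perm_map; rewrite perm_sym.
suff -> : [seq conj_repr (a j g^-1) | j <- map (act^~ g) idx] =
    [seq conj_repr (a i g)^-1 | i <- idx] by [].
rewrite -map_comp; apply/eq_in_map => i iin /=.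
have := aM i g g^-1; rewrite mulgV a1// => /esym/mulg1_eq ->.
by rewrite conj_repr_conj.
Qed.

(** Seen from all indices, a pair [z], [z^-1] gives [size idx] pairs inverse up to conjugation, each
    costing one mixed commutator. *)
Lemma cocycle_is_product (N : normalClosed G) (ys zs : seq G) :
  (forall i g, a i g \in N) ->
  perm_eq ys (zs ++ map (fun z => z^-1) zs) ->
  is_product (mixed_comms [set` N]) (size zs * size idx)
    (\prod_(i <- idx) a i (\prod_(y <- ys) y)).
Proof.
move=> aN yszs.
pose cs := [seq a i z | z <- zs, i <- idx].
have -> : \prod_(i <- idx) a i (\prod_(y <- ys) y) =
    \prod_(c <- flatten [seq cocycle_word i ys | i <- idx]) c.
  rewrite big_flatten big_map; apply: eq_big_seq => i iin.
  by rewrite prod_cocycle_word.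
rewrite -(size_allpairs (fun z i => a i z)); apply: balanced_is_product.
  by move=> c /allpairsP[[z i] [_ _ ->]]; exact: aN.
apply: perm_trans (perm_cocycle_words _) _.
apply: perm_trans (perm_allpairs _ yszs (perm_refl idx)) _.
rewrite allpairs_cat map_cat; apply: perm_cat.
  by rewrite map_allpairs.
rewrite /cs; elim: zs {yszs cs} => //= z zs' IH.
rewrite !map_cat; apply: perm_cat => //.
by rewrite -!map_comp; exact: perm_cocycleV.
Qed.

End Cocycle.

(** * Quotient projection and coset representatives *)

Lemma multiplicative1 (G H : groupType) (f : {multiplicative G -> H}) : f 1 = 1.
Proof. by apply: (mulgI (f 1)); rewrite -gmulfM !mulg1. Qed.

Lemma multiplicativeV (G H : groupType) (f : {multiplicative G -> H}) (x : G) :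
  f x^-1 = (f x)^-1.
Proof. by apply/esym/mulg1_eq; rewrite -gmulfM mulgV multiplicative1. Qed.

Lemma quot_proj_eq (G : groupType) (N : normalClosed G) (x y : G) :
  quot_proj N x = quot_proj N y <-> x^-1 * y \in N.
Proof.
rewrite /quot_proj; split=> [/eqP|xy]; first by rewrite piE.
by apply/eqP; rewrite piE.
Qed.

Lemma quot_proj_eq1 (G : groupType) (N : normalClosed G) (x : G) :
  quot_proj N x = 1 <-> x \in N.
Proof.
have <- : quot_proj N 1 = 1 by rewrite multiplicative1.
split=> [/esym|xN].
  by rewrite quot_proj_eq invg1 mul1g.
by apply/esym/quot_proj_eq; rewrite invg1 mul1g.
Qed.

Lemma left_coset_eq (Q : groupType) (L : groupClosed Q) (u v : Q) :
  left_coset L u = left_coset L v <-> u^-1 * v \in L.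
Proof.
split=> [uv|uvL].
  have [l lL <-] : left_coset L u v.
    by rewrite uv; exists 1; [exact: gpred1|rewrite mulg1].
  by rewrite mulKg.
apply/seteqP; split=> w [l lL <-].
  exists ((u^-1 * v)^-1 * l); last by rewrite !gnorm.
  by apply: gpredM => //; rewrite gpredV.
by exists (u^-1 * v * l); [exact: gpredM|rewrite !gnorm].
Qed.

(** Chosen from the coset as a set, so that equal cosets share one representative. *)
Definition coset_repr (Q : groupType) (L : groupClosed Q) (u : Q) : Q :=
  xget 1 (left_coset L u).

Lemma coset_reprP (Q : groupType) (L : groupClosed Q) (u : Q) :
  u^-1 * coset_repr L u \in L.
Proof.
have [l lL <-] : left_coset L u (coset_repr L u).
  by apply: xgetPex; exists u, 1; [exact: gpred1|rewrite mulg1].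
by rewrite mulKg.
Qed.

Lemma coset_repr_eq (Q : groupType) (L : groupClosed Q) (u v : Q) :
  u^-1 * v \in L -> coset_repr L u = coset_repr L v.
Proof. by move=> /left_coset_eq uv; rewrite /coset_repr uv. Qed.

Lemma coset_repr_mull (Q : groupType) (L : groupClosed Q) (u v : Q) :
  coset_repr L (u * coset_repr L v) = coset_repr L (u * v).
Proof.
by apply/esym/coset_repr_eq; rewrite invgM mulgA mulgVK; exact: coset_reprP.
Qed.

Lemma finite_index_reprs (Q : groupType) (L : groupClosed Q) :
  finite_index L -> exists idx : seq Q,
    uniq idx /\ forall u, u \in idx <-> exists v, u = coset_repr L v.
Proof.
move=> /(finite_image (xget 1)) /finite_seqP[r rE]; exists (undup r).
split=> [|u]; first exact: undup_uniq.
rewrite mem_undup; have -> : (u \in r) = [set` r] u :> Prop by [].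
rewrite -rE; split=> [[C [v _ <-] <-]|[v ->]]; first by exists v.
by exists (left_coset L v) => //; exists v.
Qed.

(** * The cocycle of a virtual splitting *)

Section VirtualSplitting.
Variables (G : groupType) (N : normalClosed G) (L : groupClosed (quotg N)).
Variable s : {multiplicative subgroup L -> G}.
Hypothesis sK : forall l : subgroup L, quot_proj N (s l) = val l.
Implicit Types (i : quotg N) (g h x : G).

(* For [H] the preimage of [L], [tr i g] is the element of [H] with
   [t i * g = tr i g * t (act i g)], and [a i g] is the [N]-component of
   [tr i g] in the semidirect product of [N] and the image of [s]. *)
Let act i g : quotg N := coset_repr L ((quot_proj N g)^-1 * i).
(** The inverse turns left cosets of [L] into right cosets of [H], on which [G] acts by right
    multiplication. *)
Let t i : G := repr i^-1.
Let tr i g : G := t i * g * (t (act i g))^-1.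
(** Outside [L], [insubd] falls back to 1; multiplicativity is claimed on the preimage of [L]
    only. *)
Let lift g : G := s (insubd (1 : subgroup L) (quot_proj N g)).
Let a i g : G := tr i g / lift (tr i g).

Let quot_t i : quot_proj N (t i) = i^-1.
Proof. exact: reprK. Qed.

Let quot_tr i g : quot_proj N (tr i g) \in L.
Proof.
rewrite /tr !gmulfM multiplicativeV /= !quot_t invgK.
have := coset_reprP L ((quot_proj N g)^-1 * i).
by rewrite invgM invgK.
Qed.

Let quot_lift g : quot_proj N g \in L -> quot_proj N (lift g) = quot_proj N g.
Proof. by move=> gL; rewrite sK insubdK. Qed.

Let liftM g h : quot_proj N g \in L -> quot_proj N h \in L ->
  lift (g * h) = lift g * lift h.
Proof.
move=> gL hL; rewrite -gmulfM; congr (s _); apply: val_inj.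
by rewrite gmulfM /= !insubdK ?gmulfM ?gpredM.
Qed.

Let actM i g h : act (act i g) h = act i (g * h).
Proof. by rewrite /act coset_repr_mull gmulfM invgM mulgA. Qed.

Let trM i g h : tr i (g * h) = tr i g * tr (act i g) h.
Proof. by rewrite /tr actM !gnorm. Qed.

Let a_mem i g : a i g \in N.
Proof.
apply/quot_proj_eq1; rewrite /a gmulfM multiplicativeV /= quot_lift ?quot_tr//.
by rewrite mulgV.
Qed.

Let aM i g h :
  a i (g * h) = a i g * (lift (tr i g) * a (act i g) h * (lift (tr i g))^-1).
Proof. by rewrite /a trM liftM ?quot_tr// !gnorm. Qed.

Let lift1 g : g \in N -> lift g = 1.
Proof.
move=> /quot_proj_eq1 g1; rewrite /lift g1; have <- : s 1 = 1 by rewrite multiplicative1.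
congr (s _).
by apply: val_inj; rewrite insubdK ?gpred1.
Qed.

Hypothesis L_fin : finite_index L.

(** Here [r] is the index of [L]: [2 * n] inverse pairs seen from [r] cosets give [r * 2 * n], and
    trading [r] conjugates of [x] for [x] gives the summand [r]. *)
Lemma virtual_splitting_is_product : exists2 r : nat, (0 < r)%N &
  forall (n : nat) x, x \in N -> 
    is_product [set comm g h | g in setT & h in setT] n x ->
    is_product (mixed_comms [set` N]) (r + r * 2 * n) (x ^+ r).
Proof.
have [idx [idx_uniq idxP]] := finite_index_reprs L_fin.
have act_idx i g : act i g \in idx by apply/idxP; eexists.
(* In general [act i 1] is only the chosen representative of the coset of [i]. *)
have act1 : {in idx, forall i, act i 1 = i}.
  move=> i /idxP[v ->]; rewrite /act multiplicative1 invg1 mul1g.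
  by rewrite -[X in coset_repr L X]mul1g coset_repr_mull mul1g.
have actK : {in idx, forall i g, act (act i g) g^-1 = i}.
  by move=> i iin g; rewrite actM mulgV act1.
have actN x : x \in N -> {in idx, forall i, act i x = i}.
  move=> /quot_proj_eq1 x1 i iin.
  by rewrite -[RHS]act1// /act x1 multiplicative1.
have act_perm g : perm_eq (map (act^~ g) idx) idx.
  apply: uniq_perm => //.
    rewrite map_inj_in_uniq// => i j iin jin /= ij.
    by rewrite -(actK i iin g) -(actK j jin g) ij.
  move=> i; apply/idP/idP => [/mapP[j _ ->]|iin]; first exact: act_idx.
  by apply/mapP; exists (act i g^-1) => //; have := actK i iin g^-1; rewrite invgK.
(* An element of [N] fixes every coset and has trivial lift, so only conjugation by [t i]
   remains. *)
have aN x : x \in N -> {in idx, forall i, a i x = t i * x * (t i)^-1}.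
  move=> xN i iin; have trx : tr i x = t i * x * (t i)^-1.
    by rewrite /tr actN.
  by rewrite /a lift1 ?invg1 ?mulg1 trx //; exact: gpred_conjl.
have a1 : {in idx, forall i, a i 1 = 1}.
  by move=> i iin; rewrite aN ?gpred1// !gnorm.
exists (size idx).
  by have := act_idx 1 1; case: (idx).
move=> n x xN /is_productP[cs [<- {n} csc xE]].
(* Each commutator contributes four letters; [zs] keeps [g] and [h], whose inverses are the other
   two. *)
have [ys [zs [zn yszs yE]]] : exists ys zs : seq G,
    [/\ size zs = (2 * size cs)%N, perm_eq ys (zs ++ map (fun z => z^-1) zs) &
        \prod_(c <- cs) c = \prod_(y <- ys) y].
  elim: cs csc {xE} => [|c cs IH] csc; first by exists [::], [::]; rewrite !big_nil.
  have [d dcs|ys [zs [zn yszs yE]]] := IH; first by apply: csc; rewrite inE dcs orbT.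
  have [g _ [h _ cE]] := csc c (mem_head _ _).
  exists [:: g, h, g^-1, h^-1 & ys], [:: g, h & zs]; split=> /=.
  - by rewrite zn mulnS.
  - rewrite !perm_cons perm_sym.
    rewrite (perm_catCA zs [:: g^-1; h^-1]) /= !perm_cons perm_sym //.
  - by rewrite !big_cons yE -cE /comm !mulgA.
have := cocycle_is_product act_perm a1 aM a_mem yszs.
rewrite -yE -xE zn => Xprod.
(* Each factor [t j * x * (t j)^-1] equals [comm (t j) x * x]; peeling factors off one by one
   compares the product with a power of [x]. *)
have conj_prod (js : seq (quotg N)) : {subset js <= idx} ->
    is_product (mixed_comms [set` N]) (size js)
      ((\prod_(i <- js) a i x) * (x ^+ size js)^-1).
  elim: js => [|j js IH] jsi.
    by rewrite big_nil !gnorm; exact: is_product1.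
  rewrite big_cons /= aN ?jsi ?mem_head//.
  set P := \prod_(i <- js) _ in IH *.
  rewrite (_ : _ / _ = comm (t j) x * (x * (P * (x ^+ size js)^-1) * x^-1)); last first.
    by rewrite /comm expgS !gnorm.
  rewrite -add1n; apply: is_productM.
    by apply: is_product_gen; exists (t j) => //; exists x.
  apply: is_productJ; first exact: mixed_commsJ.
  by apply: IH => i iin; apply: jsi; rewrite inE iin orbT.
(* The inverse of this correction times the product of the [a i x] is the power of [x]. *)
have := conj_prod idx (fun _ => id).
move/(is_productV (@mixed_commsV _ _))/is_productM/(_ Xprod).
by rewrite invgM invgK mulgVK [(_ * size idx)%N]mulnC mulnA.
Qed.

End VirtualSplitting.

Theorem theorem1p5 (R : realType) (G : groupType) (N : normalClosed G) :
  (exists (L : groupClosed (quotg N)) (s : {multiplicative subgroup L -> G}),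
     finite_index L /\ forall l : subgroup L, quot_proj N (s l) = val l) ->
  forall x : G, mixed_comm_subgroup [set` N] x ->
    (scl R x <= mixed_scl R [set` N] x)%R /\
    (mixed_scl R [set` N] x <= 2 * scl R x)%R.
Proof.
move=> [L [s [L_fin sK]]] x xGN.
have xN := mixed_comm_subgroup_sub xGN.
have [n xn] := generated_is_product (@mixed_commsV _ N) xGN.
(* Mixed commutators are commutators, whence the first inequality. *)
have mixed_sub m y : is_product (mixed_comms [set` N]) m y ->
    is_product [set comm g h | g in setT & h in setT] m y.
  move=> [w wS ->]; exists w => // c /wS[g _ [h _ <-]].
  by exists g => //; exists h.
have cu := fekete_cvg (R := R) (word_lengthX_subadditive xn).
have cv := fekete_cvg (R := R) (word_lengthX_subadditive (mixed_sub _ _ xn)).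
split.
  apply: ler_lim cv cu _; apply: nearW => k.
  rewrite ler_wpM2r ?invr_ge0 ?ler0n// ler_nat.
  have [xk _] := word_lengthP (is_productX k xn).
  by have [] := word_lengthP (mixed_sub _ _ xk).
have [r r0 rP] := virtual_splitting_is_product sK L_fin.
apply: (limn_div_le_double r0) => // m.
(* The bound is applied to a shortest product of commutators for [x ^+ m], whose [r]-th power is
   [x ^+ (m * r)]. *)
have [xm _] := word_lengthP (is_productX m (mixed_sub _ _ xn)).
rewrite /mixed_cl expgnA.
have xmN : x ^+ m \in N by exact: gpredXn.
by have [] := word_lengthP (rP _ _ xmN xm).
Qed.
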